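(* Let $p\in(0,1]$, $q\in(0,\infty)$ and $\mathbf u=\{u_n\},\mathbf v=\{v_n\},\mathbf w=\{w_n\}\in\mathbb R_+^{\mathbb Z}$. Define $$A_1=\sup_{\mathbf a\in\mathbb R_+^{\mathbb Z}}\Bigg(\sum_{n\in\mathbb Z}w_n\Big[\sup_{j\ge n}u_j\sup_{i\le j}a_i\Big]^q\Bigg)^{\frac1q}\Bigg(\sum_{n\in\mathbb Z}v_na_n^p\Bigg)^{-\frac1p},$$ $$A_2=\sup_{\mathbf a\in\mathbb R_+^{\mathbb Z}}\Bigg(\sum_{n\in\mathbb Z}w_n\Big[\sup_{j\ge n}u_j\sum_{i\le j}a_i\Big]^q\Bigg)^{\frac1q}\Bigg(\sum_{n\in\mathbb Z}v_na_n^p\Bigg)^{-\frac1p},$$ $$A_3=\sup_{\mathbf a\in\mathbb R_+^{\mathbb Z}}\Bigg(\sum_{n\in\mathbb Z}w_n\Big[\sup_{j\ge n}u_j^p\sum_{i\le j}a_i^p\Big]^{\frac qp}\Bigg)^{\frac1q}\Bigg(\sum_{n\in\mathbb Z}v_na_n^p\Bigg)^{-\frac1p}.$$ Then $A_1$, $A_2$ and $A_3$ are equivalent, and, moreover, the equivalence constants depend only on $q$.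
   Context: $\mathbb R_+^{\mathbb Z}$ denotes the set of all double-infinite sequences $\mathbf a=\{a_n\}_{n\in\mathbb Z}$ of nonnegative real numbers. Sums and suprema take values in $[0,\infty]$, with the conventions $0^{-\alpha}=\infty$, $\infty^{-\alpha}=0$ for $\alpha>0$, and $0\cdot\infty=0$. Quantities $A,B\in[0,\infty]$ are equivalent if there are constants $c,C\in(0,\infty)$ (the equivalence constants) with $cA\le B\le CA$. *)

(* Defs.v *)
From HB Require Import structures.
From mathcomp Require Import all_boot all_order all_algebra.
From mathcomp Require Import all_classical all_reals all_analysis.
Set Implicit Arguments.
Unset Strict Implicit.
Unset Printing Implicit Defensive.
Import Order.TTheory GRing.Theory Num.Theory.
Local Open Scope classical_set_scope.
Local Open Scope ring_scope.
Local Open Scope ereal_scope.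

Definition nneg_seq (R : realType) : set (int -> R) :=
  [set a | forall n : int, (0 <= a n)%R].

(* The power x^(-r) for r > 0 is written (x `^ r)^-1: with the extended inverse
   this gives 0^(-r) = +oo and (+oo)^(-r) = 0, whereas poweR at a negative
   exponent would send +oo to +oo and 0 to 0. *)
Definition vnorm_inv (R : realType) (p : R) (v a : int -> R) : \bar R :=
  ((\esum_(n in [set: int]) ((v n)%:E * (a n `^ p)%:E)) `^ p^-1)^-1.

Definition A1 (R : realType) (p q : R) (u v w : int -> R) : \bar R :=
  ereal_sup
    [set (\esum_(n in [set: int])
            ((w n)%:E *
             (ereal_sup [set (u j)%:E *
                             ereal_sup [set (a i)%:E
                                       | i in [set i : int | (i <= j)%R]]
                        | j in [set j : int | (n <= j)%R]]) `^ q)) `^ q^-1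
         * vnorm_inv p v a
    | a in @nneg_seq R].

Definition A2 (R : realType) (p q : R) (u v w : int -> R) : \bar R :=
  ereal_sup
    [set (\esum_(n in [set: int])
            ((w n)%:E *
             (ereal_sup [set (u j)%:E *
                             \esum_(i in [set i : int | (i <= j)%R]) (a i)%:E
                        | j in [set j : int | (n <= j)%R]]) `^ q)) `^ q^-1
         * vnorm_inv p v a
    | a in @nneg_seq R].

Definition A3 (R : realType) (p q : R) (u v w : int -> R) : \bar R :=
  ereal_sup
    [set (\esum_(n in [set: int])
            ((w n)%:E *
             (ereal_sup [set (u j `^ p)%:E *
                             \esum_(i in [set i : int | (i <= j)%R])
                                (a i `^ p)%:E
                        | j in [set j : int | (n <= j)%R]]) `^ (q / p))) `^ q^-1
         * vnorm_inv p v a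
    | a in @nneg_seq R].

Definition equivalent_with (R : realType) (c C : R) (A B : \bar R) : Prop :=
  c%:E * A <= B /\ B <= C%:E * A.

(* Main.v *)
(* Since p <= 1, sup a_i <= sum a_i <= (sum a_i^p)^(1/p), so A1 <= A2 <= A3, and only
   A3 <= 4^(1/q) A1 needs an argument.  By monotone convergence it suffices to treat
   finitely supported a; put b = a^p.

   If p <= q, the p-th power of the A3-functional is a norm-like functional of b (an
   l^(q/p) norm of suprema of sums), so by Minkowski's inequality it is controlled by
   its values on unit masses, where the A1- and A3-functionals coincide.

   If q < p, a stopping-time construction replaces b by a sparse sequence c whose
   weighted sum is no larger than that of b and whose running supremum is at least a
   quarter of the partial sums of b.  Testing A1 on c^(1/p) loses a factor
   4^(1/p) <= 4^(1/q). *)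
Require Import Defs.
From HB Require Import structures.
From mathcomp Require Import all_boot all_order all_algebra.
From mathcomp Require Import finmap.
From mathcomp Require Import all_classical all_reals all_analysis.
From mathcomp Require Import ring lra zify.
Set Implicit Arguments.
Unset Strict Implicit.
Unset Printing Implicit Defensive.
Import Order.TTheory GRing.Theory Num.Theory.
Local Open Scope classical_set_scope.
Local Open Scope ring_scope.

(** * Sparse majorants of finite sequences *)

(** Strong induction on the length. If the last term exceeds half of the total, it is kept and the
    earlier indices are handled by induction. Otherwise half of the total is reached at some
    [m <= n]: induction applies up to the first such [m], and one new mass serves the last index. *)
Lemma sparse_majorant (R : realFieldType) (v : nat -> R) (n : nat) (b : nat -> R) :
  (forall k, 0 <= v k) -> (forall k, 0 <= b k) ->
  exists c : nat -> R, [/\ forall k, 0 <= c k,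
    \sum_(k < n.+1) v k * c k <= \sum_(k < n.+1) v k * b k,
    forall j, (j <= n)%N ->
      exists2 i, (i <= j)%N & \sum_(k < j.+1) b k <= 4 * c i &
    exists2 i, (i <= n)%N & \sum_(k < n.+1) b k <= 2 * c i].
Proof.
(* The constant at the last index must be better than elsewhere: along a block over
   which the partial sums at most double, the 2 obtained at its start becomes the 4. *)
move=> v0; elim/ltn_ind: n b => -[|n] IH b b0.
  exists b; split => // [j|]; rewrite ?leqn0; first move/eqP->;
    by exists 0%N => //; rewrite big_ord1; have := b0 0%N; lra.
pose B m := \sum_(k < m.+1) b k.
have BS m : B m.+1 = B m + b m.+1 by rewrite /B big_ord_recr.
have BE m : \sum_(k < m.+1) b k = B m by [].
have B0 m : 0 <= B m by apply: sumr_ge0.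
have Bmon : {homo B : i j / (i <= j)%N >-> i <= j}.
  by apply: homo_leq => // [x y z /le_trans|m]; [apply|rewrite BS lerDl].
have [Blt|Bge] := ltP (B n) (B n.+1 / 2).
  have [c [c0 cv c4 [i ile c2]]] := IH n (ltnSn n) b b0.
  exists (fun k => if k == n.+1 then b n.+1 else c k).
  have last2 : B n.+1 <= 2 * b n.+1 by have := BS n; lra.
  split => [k||j jn|].
  - by case: ifP.
  - rewrite big_ord_recr [leRHS]big_ord_recr /= eqxx lerD2r.
    apply: le_trans cv; rewrite le_eqVlt; apply/orP; left; apply/eqP.
    by apply: eq_bigr => k _; rewrite ltn_eqF // ltnS ltnW.
  - have [jn1|jn1] := leqP j n.
      have [i' i'j ?] := c4 j jn1; exists i' => //.
      by rewrite ltn_eqF // ltnS (leq_trans i'j).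
    have -> : j = n.+1 by apply/eqP; rewrite eqn_leq jn.
    exists n.+1 => //; rewrite eqxx.
    by apply: le_trans last2 _; rewrite ler_wpM2r ?b0 // ler_nat.
  - by exists n.+1 => //; rewrite eqxx.
(* [b'] is [b] truncated at the first [m] where the mass reaches [H]; the other half of
   the mass is moved to the cheapest point [l] of [m, n + 1]. *)
pose H := B n.+1 / 2.
have [m Bm mmin] : exists2 m, H <= B m & forall k, H <= B k -> (m <= k)%N.
  have exm : exists m, H <= B m by exists n.
  by exists (ex_minn exm); case: ex_minnP.
have mn : (m <= n)%N by apply: mmin.
have H0 : 0 <= H by rewrite /H divr_ge0.
pose d := B m - H.
have d0 : 0 <= d by rewrite subr_ge0.
(* Before [m] the partial sums stay below [H], so the overshoot [d] comes from [b m] alone. *)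
have dle : d <= b m.
  rewrite /d; case: m mmin {Bm mn} d d0 => [|m] mmin _ _; first by rewrite /B big_ord1; lra.
  rewrite BS; have [/mmin|] := leP H (B m); first by rewrite ltnn.
  by lra.
pose b' k := if k == m then b m - d else b k.
have b'0 k : 0 <= b' k by rewrite /b'; case: ifP => //; rewrite subr_ge0.
have prefE (f : nat -> R) k : (k < m)%N ->
    \sum_(i < k.+1) f i * b' i = \sum_(i < k.+1) f i * b i.
  by move=> km; apply: eq_bigr => i _; rewrite /b' ltn_eqF // (leq_trans (ltn_ord i)).
have prefm (f : nat -> R) :
    \sum_(i < m.+1) f i * b' i = \sum_(i < m.+1) f i * b i - f m * d.
  rewrite !big_ord_recr /= /b' eqxx mulrBr addrA; congr (_ + _ - _).
  by apply: eq_bigr => i _; rewrite ltn_eqF.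
have B'm : \sum_(i < m.+1) b' i = H.
  have := prefm (fun=> 1); under eq_bigr do rewrite mul1r.
  by move=> ->; under eq_bigr do rewrite mul1r; rewrite BE /d; lra.
have [c [c0 cv c4 [i im c2]]] := IH m mn b' b'0.
have [l [ml ln lmin]] : exists l, [/\ (m <= l)%N, (l <= n.+1)%N &
    forall k, (m <= k)%N -> (k <= n.+1)%N -> v l <= v k].
  have mn1 : (m < n.+2)%N by lia.
  case: (arg_minP (fun i : 'I_n.+2 => v i) (P := fun i : 'I_n.+2 => (m <= i)%N)
    (i0 := Ordinal mn1) (leqnn m)) => l ml lmin.
  exists l; split => //; first by rewrite -ltnS.
  by move=> k mk kn; apply: (lmin (Ordinal (kn : (k < n.+2)%N))).
pose c' k := if (k <= m)%N then c k else 0.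
have c'0 k : 0 <= c' k by rewrite /c'; case: ifP.
exists (fun k => c' k + (if k == l then H else 0)).
have sumc k : (k <= m)%N -> c k <= c' k + (if k == l then H else 0).
  by move=> km; rewrite /c' km lerDl; case: ifP.
have suml (f : nat -> R) N : (m <= N)%N ->
    \sum_(k < N.+1) f k = \sum_(k < m.+1) f k + \sum_(m.+1 <= k < N.+1) f k.
  by move=> mN; rewrite -!(big_mkord xpredT f) -big_cat_nat.
split => [k||j jn|].
- by apply: addr_ge0 => //; case: ifP.
- under eq_bigr do rewrite mulrDr.
  rewrite big_split /=.
  have -> : \sum_(k < n.+2) v k * (if k == l :> nat then H else 0) = v l * H.
    rewrite (bigD1 (Ordinal (ln : (l < n.+2)%N))) //= eqxx big1 ?addr0 // => k kl.
    by rewrite ifN ?mulr0 //.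
  have mn1 : (m <= n.+1)%N by lia.
  rewrite (suml (fun k => v k * c' k)) // big_nat_cond [X in _ + X + _]big1 ?addr0; last first.
    by move=> k /andP[/andP[mk _] _]; rewrite /c' leqNgt mk mulr0.
  rewrite (suml (fun k => v k * b k)) //.
  have -> : \sum_(k < m.+1) v k * c' k = \sum_(k < m.+1) v k * c k.
    by apply: eq_bigr => k _; rewrite /c' -ltnS ltn_ord.
  have := cv; rewrite prefm.
  (* The moved mass [H] is the overshoot [d] at [m] together with all of [b] after [m], and at each
     of these points the weight is at least [v l]. *)
  suff : v l * H <= v m * d + \sum_(m.+1 <= k < n.+2) v k * b k by lra.
  have -> : H = d + \sum_(m.+1 <= k < n.+2) b k.
    by have := suml b n.+1 mn1; rewrite !BE /d /H; lra.
  rewrite mulrDr lerD ?ler_wpM2r ?lmin // mulr_sumr.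
  rewrite big_nat_cond [leRHS]big_nat_cond ler_sum // => k /andP[/andP[mk kn] _].
  by rewrite ler_wpM2r // lmin // ltnW.
- have [jm|jm] := ltnP j m.
    have [i' i'j le4] := c4 j (ltnW jm); exists i' => //.
    have := prefE (fun=> 1) j jm; under eq_bigr do rewrite mul1r.
    under [RHS]eq_bigr do rewrite mul1r; move=> <-.
    by apply: le_trans le4 _; rewrite ler_wpM2l // sumc //; lia.
  exists i; first exact: leq_trans im jm.
  rewrite BE; have := Bmon _ _ jn; have := sumc i im; move: c2; rewrite B'm /H; lra.
- exists l => //; rewrite BE eqxx.
  by have := c'0 l; rewrite /H; lra.
Qed.

(** * Powers, suprema and sums of extended reals *)

Section extended_reals.
Context {R : realType}.
Implicit Types (r p s t : R) (x y : \bar R).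
Local Open Scope ereal_scope.

Lemma le_poweR r x y : (0 <= r)%R -> 0 <= x -> x <= y -> x `^ r <= y `^ r.
Proof.
move=> r0 x0 xy; apply: gt0_ler_poweR => //; rewrite in_itv /= leey ?x0 //=.
by rewrite (le_trans x0 xy).
Qed.

Lemma poweRK r x : (0 < r)%R -> 0 <= x -> (x `^ r) `^ r^-1 = x.
Proof. by move=> r0 x0; rewrite -poweRrM mulfV ?gt_eqF // poweRe1. Qed.

Lemma poweRVK r x : (0 < r)%R -> 0 <= x -> (x `^ r^-1) `^ r = x.
Proof. by move=> r0 x0; rewrite -poweRrM mulVf ?gt_eqF // poweRe1. Qed.

(** The power [p] and its inverse [p^-1] are both monotone, and each gives one inequality.
    Nonemptiness of [D] keeps the supremum away from [-oo]. *)
Lemma ereal_sup_poweR (T : Type) (D : set T) (f : T -> \bar R) p :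
  (0 < p)%R -> D !=set0 -> (forall i, D i -> 0 <= f i) ->
  ereal_sup [set f i `^ p | i in D] = (ereal_sup [set f i | i in D]) `^ p.
Proof.
move=> p0 [i0 Di0] f0; apply/le_anti/andP; split.
  apply: ge_ereal_sup => _ [i Di <-]; apply: le_poweR; [exact: ltW|exact: f0|].
  by apply: ereal_sup_ubound; exists i.
have powf : 0 <= ereal_sup [set f i `^ p | i in D].
  by apply: le_ereal_sup_tmp; exists (f i0 `^ p); [exists i0|exact: poweR_ge0].
rewrite -[leRHS](@poweRVK p) //; apply: le_poweR; first exact: ltW.
  by apply: le_ereal_sup_tmp; exists (f i0); [exists i0|exact: f0].
apply: ge_ereal_sup => _ [i Di <-]; rewrite -[leLHS](@poweRK p) ?f0 //.
apply: le_poweR; rewrite ?poweR_ge0 ?invr_ge0 ?(ltW p0) //.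
by apply: ereal_sup_ubound; exists i.
Qed.

Lemma esumZl (T : choiceType) (I : set T) (f : T -> \bar R) r :
  (0 <= r)%R -> (forall i, I i -> 0 <= f i) ->
  \esum_(i in I) (r%:E * f i) = r%:E * \esum_(i in I) f i.
Proof.
move=> r0 f0; rewrite /esum -ereal_supZl //; last first.
  by apply/set0P; exists 0; exists set0; [exact: fsets_set0|rewrite fsbig_set0].
congr ereal_sup; rewrite image_comp; apply: eq_imagel => F [finF FI] /=.
rewrite !fsbig_finite //= big_seq [in RHS]big_seq ge0_sume_distrr // => i.
by rewrite in_fset_set // inE => /FI /f0.
Qed.

(** Convexity of the power [r] at the points [x / s] and [y / t] with weight [s / (s + t)]. The
    bound is linear in [x ^ r] and [y ^ r] and sharp at [(s, t)], so it can be summed term by term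
    to give Minkowski's inequality. *)
Lemma powerD_weights r s t : (1 <= r)%R -> (0 < s)%R -> (0 < t)%R ->
  exists alpha beta : R, [/\ (0 <= alpha)%R, (0 <= beta)%R,
    (alpha * s `^ r + beta * t `^ r = (s + t) `^ r)%R &
    forall x y, 0 <= x -> 0 <= y ->
      (x + y) `^ r <= alpha%:E * x `^ r + beta%:E * y `^ r].
Proof.
move=> r1 s0 t0; have st0 : (0 < s + t)%R by rewrite addr_gt0.
have r0 : (r != 0)%R by rewrite gt_eqF // (lt_le_trans _ r1).
pose lam := (s / (s + t))%R.
have lam0 : (0 < lam)%R by rewrite divr_gt0.
have lam1 : (lam <= 1)%R by rewrite ler_pdivrMr // mul1r lerDl ltW.
have lamC : (1 - lam = t / (s + t))%R.
  by rewrite /lam -[1%R in LHS](divff (lt0r_neq0 st0)) -mulrBl addrC addKr.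
have lamC0 : (0 < 1 - lam)%R by rewrite lamC divr_gt0.
pose alpha := ((s + t) `^ r * lam / s `^ r)%R.
pose beta := ((s + t) `^ r * (1 - lam) / t `^ r)%R.
have powst : (0 < (s + t) `^ r)%R by rewrite powR_gt0.
have alpha0 : (0 < alpha)%R by apply: divr_gt0; [exact: mulr_gt0|exact: powR_gt0].
have beta0 : (0 < beta)%R by apply: divr_gt0; [exact: mulr_gt0|exact: powR_gt0].
exists alpha, beta; split; rewrite ?ltW //.
  rewrite /alpha /beta !mulfVK ?gt_eqF ?powR_gt0 //.
  by rewrite -mulrDr subrKC mulr1.
(* If [x] or [y] is infinite, so is the right-hand side, because [alpha] and [beta] are positive. *)
move=> [x| |] [y| |] //= x0 y0; rewrite ?(negPf r0) ?gt0_muley ?lte_fin ?leey //.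
rewrite !lee_fin in x0 y0 *.
have : ((lam * (x / s) + (1 - lam) * (y / t)) `^ r <=
         lam * (x / s) `^ r + (1 - lam) * (y / t) `^ r)%R.
  have := @convex_powR R r r1 (@Itv01 R lam (ltW lam0) lam1) (x / s)%R (y / t)%R.
  rewrite !inE /= !in_itv /= !andbT !divr_ge0 ?(ltW s0) ?(ltW t0) //.
  by rewrite convRE [X in (X `^ _)%R]convRE; apply.
have -> : (lam * (x / s) + (1 - lam) * (y / t) = (x + y) / (s + t))%R.
  by rewrite lamC /lam; field; rewrite !gt_eqF.
have invP z c : (0 < c)%R -> (0 <= z)%R -> ((z / c) `^ r = z `^ r / c `^ r)%R.
  move=> c0 z0; rewrite powRM ?invr_ge0 ?(ltW c0) //; congr (_ * _)%R.
  by rewrite -[in LHS](powR_inv1 (ltW c0)) powRAC powR_inv1 ?powR_ge0.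
rewrite !invP ?addr_ge0 // ler_pdivrMr ?powR_gt0 // => /le_trans; apply.
by rewrite /alpha /beta le_eqVlt; apply/orP; left; apply/eqP; ring.
Qed.

(** A fraction [z / (x + y)] in [0, 1] is at most its own [p]-th power; the fractions for [x] and
    [y] add up to 1. *)
Lemma powerD_le (x y p : R) : (0 < p)%R -> (p <= 1)%R -> (0 <= x)%R ->
  (0 <= y)%R -> ((x + y) `^ p <= x `^ p + y `^ p)%R.
Proof.
move=> p0 p1 x0 y0; have [xy0|xy0] := eqVneq (x + y)%R 0%R.
  by rewrite xy0 powR0 ?gt_eqF // addr_ge0 ?powR_ge0.
have {}xy0 : (0 < x + y)%R by rewrite lt_neqAle eq_sym xy0 addr_ge0.
have frac z : (0 <= z)%R -> (z <= x + y)%R ->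
    (z / (x + y) * (x + y) `^ p <= z `^ p)%R.
  rewrite le_eqVlt => /predU1P[<- _|z0 zle]; first by rewrite !mul0r powR_ge0.
  rewrite -[in leRHS](divfK (lt0r_neq0 xy0) z) powRM ?divr_ge0 ?(ltW z0) ?(ltW xy0) //.
  rewrite ler_wpM2r ?powR_ge0 // ger1_powR // divr_gt0 //=.
  by rewrite ler_pdivrMr // mul1r.
have -> : ((x + y) `^ p = x / (x + y) * (x + y) `^ p + y / (x + y) * (x + y) `^ p)%R.
  by rewrite -mulrDl -mulrDl divff ?mul1r // gt_eqF.
by rewrite lerD ?frac ?lerDl ?lerDr.
Qed.

Lemma esum_poweR_le (T : choiceType) (I : set T) (a : T -> R) p :
  (0 < p)%R -> (p <= 1)%R -> (forall i, (0 <= a i)%R) ->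
  \esum_(i in I) (a i)%:E <= (\esum_(i in I) (a i `^ p)%:E) `^ p^-1.
Proof.
move=> p0 p1 a0; apply: ge_ereal_sup => _ [F [finF FI] <-].
have sum0 (s : seq T) : (0 <= \sum_(i <- s) a i)%R by rewrite sumr_ge0.
have sum_le (s : seq T) : ((\sum_(i <- s) a i) `^ p <= \sum_(i <- s) a i `^ p)%R.
  elim: s => [|i s IH]; first by rewrite !big_nil powR0 ?gt_eqF.
  by rewrite !big_cons (le_trans (powerD_le _ _ _ _)) ?lerD2l.
rewrite fsbig_finite //= sumEFin -[leLHS](@poweRK p) ?lee_fin ?sum0 //.
apply: le_poweR; rewrite ?poweR_ge0 ?invr_ge0 ?(ltW p0) //.
by apply: esum_ge; exists F => //; rewrite fsbig_finite //= sumEFin lee_fin.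
Qed.

End extended_reals.

(** * The weighted tail-supremum functional *)

Section tail_supremum.
Context {R : realType}.
Implicit Types (p q r : R) (u w : int -> R) (X Y : int -> \bar R) (n : int).
Local Open Scope ereal_scope.

Definition tail_sup u X n : \bar R :=
  ereal_sup [set (u j)%:E * X j | j in [set j : int | (n <= j)%R]].

(** The common form of the three numerators before the outer root: [X] is a running supremum for
    [A1] and a partial sum for [A2]; for [A3] it is a partial sum of [p]-th powers, with [u ^ p] and
    exponent [q / p]. *)
Definition hardy_sum r w u X : \bar R :=
  \esum_(n in [set: int]) ((w n)%:E * tail_sup u X n `^ r).

Lemma tail_sup_ub u X n j : (n <= j)%R -> (u j)%:E * X j <= tail_sup u X n.
Proof. by move=> nj; apply: ereal_sup_ubound; exists j. Qed.

Lemma tail_sup_ge0 u X n : nneg_seq u -> (forall j, 0 <= X j) ->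
  0 <= tail_sup u X n.
Proof.
by move=> u0 X0; apply: le_trans (tail_sup_ub u X (lexx n)); rewrite mule_ge0 ?lee_fin.
Qed.

Lemma le_tail_sup u X Y n : nneg_seq u -> (forall j, X j <= Y j) ->
  tail_sup u X n <= tail_sup u Y n.
Proof.
move=> u0 XY; apply: ge_ereal_sup => _ [j nj <-].
by apply: le_trans (tail_sup_ub u Y nj); rewrite lee_wpmul2l ?lee_fin.
Qed.

Lemma tail_supD u X Y n : nneg_seq u ->
  (forall j, 0 <= X j) -> (forall j, 0 <= Y j) ->
  tail_sup u (X \+ Y) n <= tail_sup u X n + tail_sup u Y n.
Proof.
move=> u0 X0 Y0; apply: ge_ereal_sup => _ [j nj <-].
by rewrite ge0_muleDr // leeD ?tail_sup_ub.
Qed.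

Lemma tail_supZ u X n (c : R) : (0 <= c)%R ->
  tail_sup u (fun j => c%:E * X j) n = c%:E * tail_sup u X n.
Proof.
move=> c0; rewrite /tail_sup -ereal_supZl //; last first.
  by apply/set0P; exists ((u n)%:E * X n); exists n => //=.
by congr ereal_sup; rewrite image_comp; apply: eq_imagel => j _; rewrite muleCA.
Qed.

Lemma tail_sup_poweR p u X n : (0 < p)%R -> nneg_seq u ->
  (forall j, 0 <= X j) ->
  tail_sup (fun j => u j `^ p)%R (fun j => X j `^ p) n = tail_sup u X n `^ p.
Proof.
move=> p0 u0 X0; rewrite /tail_sup -ereal_sup_poweR //.
- congr ereal_sup; apply: eq_imagel => j _.
  by rewrite poweRM ?lee_fin.
- by exists n => /=.
- by move=> j _; rewrite mule_ge0 ?lee_fin.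
Qed.

Lemma hardy_term_ge0 r w u X n : nneg_seq w ->
  0 <= (w n)%:E * tail_sup u X n `^ r.
Proof. by move=> w0; rewrite mule_ge0 ?lee_fin ?poweR_ge0. Qed.

Lemma hardy_sum_ge0 r w u X : nneg_seq w -> 0 <= hardy_sum r w u X.
Proof. by move=> w0; apply: esum_ge0 => n _; exact: hardy_term_ge0. Qed.

Lemma le_hardy_sum r w u X Y : (0 <= r)%R -> nneg_seq w -> nneg_seq u ->
  (forall j, 0 <= X j) -> (forall j, X j <= Y j) ->
  hardy_sum r w u X <= hardy_sum r w u Y.
Proof.
move=> r0 w0 u0 X0 XY; apply: le_esum => n _.
by rewrite lee_wpmul2l ?lee_fin // le_poweR ?tail_sup_ge0 ?le_tail_sup.
Qed.

(** Powers commute with suprema. This passes between the exponent [q] of [A1] and [A2] and the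
    exponent [q / p] of [A3]. *)
Lemma hardy_sum_poweR p q w u X : (0 < p)%R -> nneg_seq u ->
  (forall j, 0 <= X j) ->
  hardy_sum (q / p) w (fun j => u j `^ p)%R (fun j => X j `^ p) =
  hardy_sum q w u X.
Proof.
move=> p0 u0 X0; apply: eq_esum => n _; rewrite tail_sup_poweR // -poweRrM.
by rewrite mulrCA divff ?mulr1 ?gt_eqF.
Qed.

Lemma hardy_sumZ r w u X (c : R) : (0 <= c)%R -> nneg_seq w -> nneg_seq u ->
  (forall j, 0 <= X j) ->
  hardy_sum r w u (fun j => c%:E * X j) = (c `^ r)%:E * hardy_sum r w u X.
Proof.
move=> c0 w0 u0 X0; rewrite /hardy_sum -esumZl ?powR_ge0 //; last first.
  by move=> n _; exact: hardy_term_ge0.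
apply: eq_esum => n _; rewrite tail_supZ // poweRM ?lee_fin ?tail_sup_ge0 //.
by rewrite poweR_EFin muleCA.
Qed.

(** Minkowski's inequality in terms of bounds [s], [t] for the two norms. With the weights of
    [powerD_weights] at [(s, t)] the pointwise estimates sum up, and the bounds recombine to exactly
    [(s + t) ^ r]. *)
Lemma hardy_sum_minkowski r w u X Y (s t : R) : (1 <= r)%R ->
  nneg_seq w -> nneg_seq u -> (forall j, 0 <= X j) -> (forall j, 0 <= Y j) ->
  (0 < s)%R -> (0 < t)%R ->
  hardy_sum r w u X <= (s `^ r)%:E -> hardy_sum r w u Y <= (t `^ r)%:E ->
  hardy_sum r w u (X \+ Y) <= ((s + t) `^ r)%:E.
Proof.
move=> r1 w0 u0 X0 Y0 s0 t0 Xs Yt.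
have r0 : (0 <= r)%R by exact: le_trans r1.
have [alpha [beta [alpha0 beta0 <- powD]]] := powerD_weights r1 s0 t0.
rewrite EFinD !EFinM.
apply: le_trans (leeD (lee_wpmul2l _ Xs) (lee_wpmul2l _ Yt)); rewrite ?lee_fin //.
rewrite -!esumZl //; try by move=> n _; exact: hardy_term_ge0.
rewrite -esumD; try by move=> n _; rewrite mule_ge0 ?lee_fin ?hardy_term_ge0.
apply: le_esum => n _; rewrite !(muleCA _ (w n)%:E) -ge0_muleDr.
- rewrite lee_wpmul2l ?lee_fin //.
  apply: le_trans (powD _ _ (tail_sup_ge0 _ u0 X0) (tail_sup_ge0 _ u0 Y0)).
  by rewrite le_poweR ?tail_supD ?tail_sup_ge0 // => j; rewrite adde_ge0.
- by rewrite mule_ge0 ?lee_fin ?poweR_ge0.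
- by rewrite mule_ge0 ?lee_fin ?poweR_ge0.
Qed.

(** Monotone convergence, which allows partial sums to be replaced by finite ones. Over finitely
    many [n] the limit in [N] is taken term by term, and the finite sums stay below [K]. *)
Lemma hardy_sum_le_lim r w u X (Y : nat -> int -> \bar R) (K : \bar R) :
  (0 < r)%R -> nneg_seq w -> nneg_seq u -> (forall j, 0 <= X j) ->
  (forall N j, 0 <= Y N j) ->
  (forall j, {homo Y ^~ j : M N / (M <= N)%N >-> M <= N}) ->
  (forall j, X j <= ereal_sup (range (Y ^~ j))) ->
  (forall N, hardy_sum r w u (Y N) <= K) -> hardy_sum r w u X <= K.
Proof.
move=> r0 w0 u0 X0 Y0 Ynd XY YK; apply: ge_ereal_sup => _ [F [finF _] <-].
pose g N n := (w n)%:E * tail_sup u (Y N) n `^ r.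
have gnd n : {homo g ^~ n : M N / (M <= N)%N >-> M <= N}.
  move=> M N MN; rewrite /g lee_wpmul2l ?lee_fin // le_poweR ?(ltW r0) //.
    exact: tail_sup_ge0.
  by apply: le_tail_sup => // j; exact: Ynd.
(* The weight, the power and the supremum over [j] all pass through the supremum over [N]. *)
have gsup n : (w n)%:E * tail_sup u X n `^ r <= ereal_sup (range (g ^~ n)).
  have -> : range (g ^~ n) =
      [set (w n)%:E * x | x in [set tail_sup u (Y N) n `^ r | N in [set: nat]]].
    by rewrite image_comp.
  rewrite ereal_supZl //; last by apply/set0P; exists (tail_sup u (Y 0%N) n `^ r), 0%N.
  rewrite lee_wpmul2l ?lee_fin // ereal_sup_poweR //; last first.
    by move=> N _; exact: tail_sup_ge0.
  rewrite le_poweR ?(ltW r0) ?tail_sup_ge0 //.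
  apply: ge_ereal_sup => _ [j nj <-].
  apply: le_trans (lee_wpmul2l _ (XY j)) _; rewrite ?lee_fin //.
  rewrite -ereal_supZl //; last by apply/set0P; exists (Y 0%N j), 0%N.
  apply: ge_ereal_sup => _ [_ [N _ <-] <-].
  apply: le_trans (tail_sup_ub _ _ nj) _.
  by apply: ereal_sup_ubound; exists N.
rewrite fsbig_finite //=.
apply: le_trans (lee_sum _ (fun n _ => gsup n)) _.
have gcvg (s : seq int) : \sum_(n <- s) g N n @[N --> \oo] -->
    \sum_(n <- s) ereal_sup (range (g ^~ n)).
  apply: cvg_nnesum => n _; first by apply: nearW => N; exact: hardy_term_ge0.
  exact: ereal_nondecreasing_cvgn (gnd n).
apply: cvge_le (gcvg _); apply: nearW => N; apply: le_trans (YK N).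
by apply: esum_ge; exists F => //; rewrite fsbig_finite.
Qed.

End tail_supremum.

(** * Exhaustion of the integers by finite windows *)

Lemma ler_sum_uniq_subset (R : realDomainType) (T : eqType) (s s' : seq T)
    (f : T -> R) :
  uniq s -> uniq s' -> (forall i, 0 <= f i) ->
  {in s, forall i, f i != 0 -> i \in s'} ->
  \sum_(i <- s) f i <= \sum_(i <- s') f i.
Proof.
move=> us us' f0 ss'.
have -> : \sum_(i <- s) f i = \sum_(i <- s | i \in s') f i.
  rewrite [RHS]big_mkcond; apply: eq_big_seq => i /ss'.
  by case: (i \in s') => // fi; apply/eqP/negPn/negP => /fi.
rewrite -big_filter.
have perm_ss : perm_eq [seq i <- s | i \in s'] [seq i <- s' | i \in s].
  by apply: uniq_perm; rewrite ?filter_uniq // => i; rewrite !mem_filter andbC.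
rewrite (perm_big _ perm_ss) big_filter big_mkcond; apply: ler_sum => i _.
by case: ifP.
Qed.

(** The integers from [-N] to [N], listed by the shift [k - N] from 0 to [2N], so that results on
    initial segments of the naturals carry over. *)
Definition window (N : nat) : seq int :=
  [seq k%:Z - N%:Z | k <- iota 0 N.*2.+1].

Lemma window_uniq N : uniq (window N).
Proof. by rewrite map_inj_uniq ?iota_uniq // => x y /=; lia. Qed.

Lemma mem_window N (i : int) : (i \in window N) = (`|i|%N <= N)%N.
Proof.
apply/mapP/idP => [[k]|iN]; first by rewrite mem_iota => kN ->; lia.
exists (absz (i + N%:Z)); first by rewrite mem_iota; lia.
by lia.
Qed.

Lemma big_window (R : nmodType) (f : int -> R) N :
  \sum_(i <- window N) f i = \sum_(k < N.*2.+1) f (k%:Z - N%:Z).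
Proof.
by rewrite big_map -(big_mkord xpredT (fun k : nat => f (k%:Z - N%:Z))) /index_iota subn0.
Qed.

Section windows.
Context {R : realType}.
Implicit Types f b : int -> R.
Local Open Scope ereal_scope.

Lemma window_sum_le_esum f N : (forall i, (0 <= f i)%R) ->
  (\sum_(i <- window N) f i)%R%:E <= \esum_(i in [set: int]) (f i)%:E.
Proof.
move=> f0; apply: esum_ge; exists [set` window N].
  by split; [exact: finite_seq|exact: subsetT].
by rewrite -fsbig_seq ?window_uniq // sumEFin.
Qed.

Lemma esum_window_support f N : (forall i, (0 <= f i)%R) ->
  (forall i, f i != 0%R -> i \in window N) ->
  \esum_(i in [set: int]) (f i)%:E = (\sum_(i <- window N) f i)%R%:E.
Proof.
move=> f0 fN; apply/le_anti; rewrite window_sum_le_esum // andbT.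
apply: ge_ereal_sup => _ [F [finF _] <-]; rewrite fsbig_finite //= sumEFin lee_fin.
apply: ler_sum_uniq_subset; rewrite ?window_uniq ?fset_uniq //.
by move=> i _; exact: fN.
Qed.

Definition window_sum b N (j : int) : R :=
  (\sum_(i <- window N | (i <= j)%R) b i)%R.

Lemma window_sum_nondecreasing b j : (forall i, (0 <= b i)%R) ->
  {homo window_sum b ^~ j : M N / (M <= N)%N >-> (M <= N)%R}.
Proof.
move=> b0 M N MN; rewrite /window_sum big_mkcond [leRHS]big_mkcond.
apply: (ler_sum_uniq_subset (window_uniq _) (window_uniq _)) => [i|i].
  by case: ifP.
by rewrite !mem_window => iM _; exact: leq_trans MN.
Qed.

Lemma esum_le_window_sum b j : (forall i, (0 <= b i)%R) ->
  \esum_(i in [set i : int | (i <= j)%R]) (b i)%:E <=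
  ereal_sup (range (fun N => (window_sum b N j)%:E)).
Proof.
move=> b0; apply: ge_ereal_sup => _ [F [finF Fj] <-].
pose N := (\max_(i <- fset_set F) `|i|)%N.
apply: le_ereal_sup_tmp; exists (window_sum b N j)%:E; first by exists N.
rewrite fsbig_finite //= sumEFin lee_fin /window_sum.
rewrite big_seq big_mkcond [leRHS]big_mkcond.
have bif (P : pred int) i : (0 <= if P i then b i else 0)%R by case: ifP.
apply: le_trans (_ : _ <= \sum_(i <- fset_set F) if (i <= j)%R then b i else 0)%R _.
  apply: ler_sum => i _; case: ifP => iF; last exact: (bif (fun i => i <= j)%R).
  by rewrite ifT //; apply: Fj; rewrite in_fset_set // inE in iF.
apply: (ler_sum_uniq_subset (fset_uniq _) (window_uniq _)) => [i|i iF _].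
  exact: (bif (fun i => i <= j)%R).
by rewrite mem_window; apply: (@leq_bigmax_seq _ _ (fun=> true) (fun i : int => absz i)).
Qed.

End windows.

(** * Running suprema and superposition of unit masses *)

Section hardy.
Context {R : realType}.
Implicit Types (p q r A : R) (u v w a b : int -> R).
Local Open Scope ereal_scope.

Definition running_sup a (j : int) : \bar R :=
  ereal_sup [set (a i)%:E | i in [set i : int | (i <= j)%R]].

Lemma running_sup_ub a (i j : int) : (i <= j)%R -> (a i)%:E <= running_sup a j.
Proof. by move=> ij; apply: ereal_sup_ubound; exists i. Qed.

Lemma running_sup_ge0 a j : nneg_seq a -> 0 <= running_sup a j.
Proof.
by move=> a0; apply: le_trans (running_sup_ub a (lexx j)); rewrite lee_fin.
Qed.

(** As a function of [j], both the partial sums and the running supremum of a unit mass at [i]. *)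
Definition step (i j : int) : R := ((i <= j)%R)%:R.

(** Partial sums of [b] are combinations of steps with coefficients [b i], so Minkowski's inequality
    is iterated. The slack [eps], halved at each step, keeps both bounds positive as that inequality
    requires. *)
Lemma hardy_sum_windowed r w u (m b : int -> R) (s : seq int) (eps : R) :
  (1 <= r)%R -> nneg_seq w -> nneg_seq u -> nneg_seq b -> nneg_seq m ->
  (forall i, hardy_sum r w u (fun j => (step i j)%:E) <= (m i `^ r)%:E) ->
  (0 < eps)%R ->
  hardy_sum r w u (fun j => (\sum_(i <- s | (i <= j)%R) b i)%R%:E) <=
    ((\sum_(i <- s) m i * b i + eps) `^ r)%R%:E.
Proof.
move=> r1 w0 u0 b0 m0 mE; elim: s eps => [|i s IH] eps eps0.
  (* The empty sum is written as 0 times a step so that homogeneity gives the value 0. *)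
  have -> : (fun j : int => (\sum_(i <- [::] | (i <= j)%R) b i)%R%:E) =
            (fun j => 0%:E * (step 0 j)%:E).
    by apply/funext => j; rewrite big_nil mul0e.
  have r_neq0 : (r != 0)%R by rewrite gt_eqF // (lt_le_trans _ r1).
  rewrite hardy_sumZ //; first by rewrite powR0 // mul0e lee_fin powR_ge0.
  by move=> j; rewrite lee_fin ler0n.
have -> : (fun j : int => (\sum_(k <- i :: s | (k <= j)%R) b k)%R%:E) =
    (fun j => (b i)%:E * (step i j)%:E) \+
    (fun j => (\sum_(k <- s | (k <= j)%R) b k)%R%:E).
  apply/funext => j /=; rewrite big_cons /step.
  by case: ifP => _; rewrite ?mulr1 ?mule1 ?mule0 ?add0e.
have mb0 k : (0 <= m k * b k)%R by rewrite mulr_ge0.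
have -> : (\sum_(k <- i :: s) m k * b k + eps =
    (m i * b i + eps / 2) + (\sum_(k <- s) m k * b k + eps / 2))%R.
  by rewrite big_cons; field.
have eps2 : (0 < eps / 2)%R by rewrite divr_gt0.
apply: hardy_sum_minkowski => //.
- by move=> j; rewrite mule_ge0 ?lee_fin ?ler0n.
- by move=> j; rewrite lee_fin sumr_ge0.
- by rewrite ltr_wpDl.
- by rewrite ltr_wpDl ?sumr_ge0.
- rewrite hardy_sumZ //; last by move=> j; rewrite lee_fin ler0n.
  apply: le_trans (lee_wpmul2l _ (mE i)) _; rewrite ?lee_fin ?powR_ge0 //.
  rewrite -powRM // mulrC ge0_ler_powR ?nnegrE ?addr_ge0 ?(ltW eps2) //.
    exact: le_trans r1.
  by rewrite lerDl ltW.
- exact: IH.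
Qed.

(** The slack is removed by comparing [r]-th roots, where [eps] enters additively. *)
Lemma hardy_sum_window_step r w u (m b : int -> R) N :
  (1 <= r)%R -> nneg_seq w -> nneg_seq u -> nneg_seq b -> nneg_seq m ->
  (forall i, hardy_sum r w u (fun j => (step i j)%:E) <= (m i `^ r)%:E) ->
  hardy_sum r w u (fun j => (window_sum b N j)%:E) <=
    ((\sum_(i <- window N) m i * b i) `^ r)%R%:E.
Proof.
move=> r1 w0 u0 b0 m0 mE; have r0 : (0 < r)%R by exact: lt_le_trans r1.
have mb0 : (0 <= \sum_(i <- window N) m i * b i)%R.
  by apply: sumr_ge0 => i _; rewrite mulr_ge0.
rewrite -[leLHS](@poweRVK _ r) ?hardy_sum_ge0 // -poweR_EFin.
apply: le_poweR; rewrite ?(ltW r0) ?poweR_ge0 //.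
apply/lee_addgt0Pr => eps eps0.
rewrite -EFinD -[leRHS](@poweRK _ r) ?lee_fin ?addr_ge0 ?(ltW eps0) //.
apply: le_poweR; rewrite ?invr_ge0 ?(ltW r0) ?hardy_sum_ge0 //.
exact: hardy_sum_windowed.
Qed.

Lemma le_mule_inve (x y : \bar R) (A : R) : (0 <= A)%R -> 0 <= x -> 0 <= y ->
  x <= A%:E * y -> x * y^-1 <= A%:E.
Proof.
move=> A0 x0; case: y => [y| |] //; last by rewrite invey mule0 lee_fin.
rewrite lee_fin le_eqVlt => /predU1P[<-|y0 xA].
  by rewrite mule0 => xle; rewrite (le_anti (introT andP (conj xle x0))) mul0e lee_fin.
by rewrite inver gt_eqF // lee_pdivrMr.
Qed.

(** For [y = 0] the bound forces [x = 0], since otherwise the product is infinite. At [y = +oo] the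
    product is 0 and says nothing about [x]. *)
Lemma mule_inve_le (x y : \bar R) (A : R) : 0 <= x -> 0 <= y -> y != +oo ->
  x * y^-1 <= A%:E -> x <= A%:E * y.
Proof.
move=> x0; case: y => [y| |] //.
rewrite lee_fin le_eqVlt => /predU1P[<- _|y0 _].
  rewrite inve0 mule0; have [-> //|xN0] := eqVneq x 0.
  by rewrite gt0_muley ?lt0e ?xN0 // leye_eq.
by rewrite inver gt_eqF // lee_pdivrMr.
Qed.

(** * Bounding [A3] when [A1] is a finite number [A] *)

Section bounded_constant.
Variables (p q A : R) (u v w : int -> R).
Hypotheses (p0 : (0 < p)%R) (q0 : (0 < q)%R) (A0 : (0 <= A)%R).
Hypotheses (u0 : nneg_seq u) (v0 : nneg_seq v) (w0 : nneg_seq w).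
Hypothesis A1A : A1 p q u v w = A%:E.

Let up j : R := (u j `^ p)%R.

Let up0 : nneg_seq up. Proof. by move=> j; exact: powR_ge0. Qed.

Let qp0 : (0 < q / p)%R. Proof. exact: divr_gt0. Qed.

(** The definition of [A1] tested on [a], with the denominator cleared, which is possible as [V] is
    finite, and raised to the power [q]. *)
Lemma hardy_sum_running_sup a (V : R) : nneg_seq a ->
  \esum_(n in [set: int]) ((v n)%:E * (a n `^ p)%:E) = V%:E ->
  hardy_sum q w u (running_sup a) <= (A `^ q * V `^ (q / p))%R%:E.
Proof.
move=> a0 VE; have V0 : (0 <= V)%R.
  by rewrite -lee_fin -VE; apply: esum_ge0 => n _; rewrite mule_ge0 ?lee_fin ?powR_ge0.
have : hardy_sum q w u (running_sup a) `^ q^-1 * vnorm_inv p v a <= A%:E.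
  by rewrite -A1A; apply: ereal_sup_ubound; exists a.
rewrite /vnorm_inv VE => /mule_inve_le; rewrite !poweR_ge0 => /(_ isT isT isT) le.
rewrite -[leLHS](@poweRVK _ q) ?hardy_sum_ge0 //.
apply: le_trans (le_poweR (ltW q0) (poweR_ge0 _ _) le) _.
by rewrite poweRM ?lee_fin ?powR_ge0 //= -powRrM [(p^-1 * q)%R]mulrC.
Qed.

Lemma running_sup_delta (i0 j : int) :
  (step i0 j)%:E <= running_sup (fun i => (i == i0)%:R) j.
Proof.
rewrite /step; case: (boolP (i0 <= j)%R) => [ij|_]; last first.
  by apply: running_sup_ge0 => i; rewrite ler0n.
by have := running_sup_ub (fun i => (i == i0)%:R%R) ij; rewrite eqxx.
Qed.

(** [A1] is tested on the unit mass at [i0], whose weighted sum is [v i0]. *)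
Lemma hardy_sum_step (i0 : int) :
  hardy_sum (q / p) w up (fun j => (step i0 j)%:E) <=
    ((A `^ p * v i0) `^ (q / p))%R%:E.
Proof.
pose e (i : int) : R := (i == i0)%:R.
have e0 : nneg_seq e by move=> i; rewrite ler0n.
have eV : \esum_(n in [set: int]) ((v n)%:E * (e n `^ p)%:E) = (v i0)%:E.
  rewrite -(@esum_set1 _ _ i0 (fun i => (v i)%:E)) ?lee_fin //.
  rewrite [RHS]esum_mkcond; apply: eq_esum => n _; rewrite /e classical_sets.in_set1.
  by case: eqP => _; rewrite ?powR1 ?mule1 // powR0 ?mule0 // gt_eqF.
(* A function with values 0 and 1 equals its [p]-th power, so the exponent can return from [q / p]
   to [q]. *)
have -> : (fun j => (step i0 j)%:E) = (fun j => (step i0 j)%:E `^ p).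
  apply/funext => j; rewrite poweR_EFin /step.
  by case: (i0 <= j)%R; rewrite ?mulr1n ?powR1 ?mulr0n ?powR0 ?gt_eqF.
have step0 j : 0 <= (step i0 j)%:E by rewrite lee_fin ler0n.
rewrite hardy_sum_poweR //.
apply: le_trans (le_hardy_sum (ltW q0) w0 u0 step0 (running_sup_delta i0)) _.
apply: le_trans (hardy_sum_running_sup e0 eV) _.
rewrite powRM ?powR_ge0 // -powRrM mulrCA divff ?mulr1 ?gt_eqF //.
Qed.

(** The case [p <= q]: superposition with the unit-mass bounds [A ^ p * v i], from which [A ^ q]
    factors out. *)
Lemma hardy_sum_window_ge1 b N : (1 <= q / p)%R -> nneg_seq b ->
  hardy_sum (q / p) w up (fun j => (window_sum b N j)%:E) <=
    (A `^ q * (\sum_(i <- window N) v i * b i) `^ (q / p))%R%:E.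
Proof.
move=> qp1 b0.
have m0 : nneg_seq (fun i => A `^ p * v i)%R by move=> i; rewrite mulr_ge0 ?powR_ge0.
apply: le_trans (hardy_sum_window_step N qp1 w0 up0 b0 m0 hardy_sum_step) _.
under eq_bigr do rewrite -mulrA.
rewrite -mulr_sumr powRM ?powR_ge0 ?sumr_ge0 // => [|i _]; last by rewrite mulr_ge0.
by rewrite -powRrM mulrCA divff ?mulr1 ?gt_eqF.
Qed.

(** [sparse_majorant] shifted to the window and extended by 0. The first alternative covers [j] to
    the left of the window, where the sum is empty. *)
Lemma sparse_majorant_window b N : nneg_seq b ->
  exists c : int -> R, [/\ nneg_seq c, forall i, c i != 0%R -> i \in window N,
    (\sum_(i <- window N) v i * c i <= \sum_(i <- window N) v i * b i)%R &
    forall j, window_sum b N j = 0%R \/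
      exists2 i, (i <= j)%R & (window_sum b N j <= 4 * c i)%R].
Proof.
move=> b0; pose s (k : nat) : int := (k%:Z - N%:Z)%R.
have [c [c0 cv c4 _]] := @sparse_majorant R (v \o s) N.*2 (b \o s)
  (fun k => v0 (s k)) (fun k => b0 (s k)).
have sK (k : nat) : absz (s k + N%:Z)%R = k by rewrite /s; lia.
pose c' (i : int) : R := if i \in window N then c (absz (i + N%:Z)%R) else 0%R.
have c's (k : nat) : (k <= N.*2)%N -> c' (s k) = c k.
  by move=> kN; rewrite /c' sK mem_window ifT // /s; lia.
exists c'; split => [i|i||j].
- by rewrite /c'; case: ifP.
- by rewrite /c'; case: ifP => //; rewrite eqxx.
- rewrite !big_window; apply: le_trans cv.
  by apply: ler_sum => k _; rewrite c's // -ltnS ltn_ord.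
have [jN|jN] := ltP j (- N%:Z)%R.
  left; rewrite /window_sum big_seq_cond big1 // => i /andP[+ ij].
  by rewrite mem_window; lia.
(* To the right of the window the sum no longer grows, so the shifted index of [j] is capped at
   [2N]. *)
right; pose k := minn (absz (j + N%:Z)%R) N.*2.
have kN : (k <= N.*2)%N by exact: geq_minr.
have [i ik le4] := c4 k kN.
exists (s i); first by rewrite /s /k in ik *; lia.
rewrite c's ?(leq_trans ik) //; apply: le_trans le4.
pose f (l : nat) : R := if (s l <= j)%R then b (s l) else 0%R.
have f0 l : (0 <= f l)%R by rewrite /f; case: ifP.
rewrite /window_sum big_map big_mkcond.
apply: le_trans (_ : _ <= \sum_(l <- iota 0 k.+1) f l)%R _.
  apply: ler_sum_uniq_subset; rewrite ?iota_uniq // => l.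
  rewrite !mem_iota /f /k => lN; case: ifP; rewrite ?eqxx // /s => sj _.
  by lia.
rewrite -[X in iota 0 X]subn0 -/(index_iota 0 k.+1) big_mkord.
by apply: ler_sum => l _; rewrite /f /=; case: ifP.
Qed.

(** The case [q < p]: the test sequence is the [p]-th root of the sparse majorant [c], so partial
    sums of [b] are at most 4 times the [p]-th power of its running supremum. *)
Lemma hardy_sum_window_lt1 b N : (q < p)%R -> nneg_seq b ->
  hardy_sum (q / p) w up (fun j => (window_sum b N j)%:E) <=
    (4 * (A `^ q * (\sum_(i <- window N) v i * b i) `^ (q / p)))%R%:E.
Proof.
move=> qp b0; have [c [c0 cN cv c4]] := sparse_majorant_window N b0.
pose a i : R := (c i `^ p^-1)%R.
have a0 : nneg_seq a by move=> i; exact: powR_ge0.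
have ap i : (a i `^ p = c i)%R by rewrite /a -powRrM mulVf ?gt_eqF // powRr1.
have aV : \esum_(n in [set: int]) ((v n)%:E * (a n `^ p)%:E) =
    (\sum_(i <- window N) v i * c i)%R%:E.
  rewrite -esum_window_support.
  - by apply: eq_esum => n _; rewrite ap.
  - by move=> i; rewrite mulr_ge0.
  - by move=> i; rewrite mulf_eq0 negb_or => /andP[_ /cN].
have sup0 j : 0 <= running_sup a j by exact: running_sup_ge0.
have ws0 j : 0 <= (window_sum b N j)%:E by rewrite lee_fin sumr_ge0.
have wsle j : (window_sum b N j)%:E <= 4%:E * running_sup a j `^ p.
  have [->|[i ij le4]] := c4 j; first by rewrite mule_ge0 ?poweR_ge0 ?lee_fin.
  apply: (@le_trans _ _ (4%:E * (a i)%:E `^ p)).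
    by rewrite poweR_EFin ap -EFinM lee_fin.
  rewrite lee_wpmul2l ?lee_fin // le_poweR ?(ltW p0) ?lee_fin //.
  exact: running_sup_ub.
apply: le_trans (le_hardy_sum (ltW qp0) w0 up0 ws0 wsle) _.
rewrite hardy_sumZ //; last by move=> j; exact: poweR_ge0.
rewrite hardy_sum_poweR // EFinM lee_pmul ?lee_fin ?powR_ge0 ?hardy_sum_ge0 //.
  (* Homogeneity produces [4 ^ (q / p)], which is at most 4 as [q < p]; this removes the dependence
     on [p]. *)
  by rewrite ler1_powR ?ler_pdivrMr ?mul1r ?(ltW qp) // ler1n.
apply: le_trans (hardy_sum_running_sup a0 aV) _.
rewrite lee_fin ler_wpM2l ?powR_ge0 // ge0_ler_powR ?nnegrE ?(ltW qp0) //;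
  by apply: sumr_ge0 => i _; rewrite mulr_ge0.
Qed.

Lemma A3_le : A3 p q u v w <= (4 `^ q^-1)%:E * A%:E.
Proof.
apply: ge_ereal_sup => _ [a a0 <-].
pose b i : R := (a i `^ p)%R.
have b0 : nneg_seq b by move=> i; exact: powR_ge0.
pose V := \esum_(n in [set: int]) ((v n)%:E * (a n `^ p)%:E).
have V0 : 0 <= V by apply: esum_ge0 => n _; rewrite mule_ge0 ?lee_fin ?powR_ge0.
pose X j := \esum_(i in [set i : int | (i <= j)%R]) (b i)%:E.
rewrite -EFinM; apply: le_mule_inve; rewrite ?poweR_ge0 ?mulr_ge0 ?powR_ge0 //.
(* The target is put in the form of a [q]-th root, so that only the sums under the roots need
   comparing. *)
have powq : (4 `^ q^-1 * A)%R%:E * V `^ p^-1 =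
    ((4 * A `^ q)%R%:E * V `^ (q / p)) `^ q^-1.
  rewrite poweRM ?poweR_ge0 ?lee_fin ?mulr_ge0 ?powR_ge0 //.
  rewrite -poweRrM mulrAC divff ?mul1r ?gt_eqF //; congr (_ * _).
  by rewrite /= powRM ?powR_ge0 // -powRrM divff ?powRr1 ?gt_eqF.
rewrite -/V powq.
apply: le_poweR; rewrite ?invr_ge0 ?(ltW q0) //.
  by apply: esum_ge0 => n _; rewrite mule_ge0 ?lee_fin ?poweR_ge0.
change (hardy_sum (q / p) w up X <= (4 * A `^ q)%R%:E * V `^ (q / p)).
apply: (@hardy_sum_le_lim _ _ _ _ _ (fun N j => (window_sum b N j)%:E)) => //.
- by move=> j; apply: esum_ge0 => i _; rewrite lee_fin.
- by move=> N j; rewrite lee_fin sumr_ge0.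
- by move=> j M N MN; rewrite lee_fin window_sum_nondecreasing.
- by move=> j; exact: esum_le_window_sum.
move=> N; pose VN := (\sum_(i <- window N) v i * b i)%R.
have vb0 i : (0 <= v i * b i)%R by rewrite mulr_ge0.
have VN0 : (0 <= VN)%R by exact: sumr_ge0.
have VNV : VN%:E <= V by exact: window_sum_le_esum.
(* A bound common to both cases; for [p <= q] the factor 4 is merely added. *)
apply: (@le_trans _ _ (4 * (A `^ q * VN `^ (q / p)))%R%:E).
  have [qp|pq] := ltP q p; first exact: hardy_sum_window_lt1.
  apply: le_trans (hardy_sum_window_ge1 N _ b0) _; first by rewrite ler_pdivlMr ?mul1r.
  by rewrite lee_fin ler_peMl ?mulr_ge0 ?powR_ge0 // ler1n.
rewrite mulrA EFinM lee_wpmul2l ?lee_fin ?mulr_ge0 ?powR_ge0 //.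
by rewrite -poweR_EFin le_poweR ?(ltW qp0) ?lee_fin.
Qed.

End bounded_constant.

(** * Comparison of the three constants *)

Lemma A1_le_A2 p q u v w : (0 < q)%R -> nneg_seq u -> nneg_seq w ->
  A1 p q u v w <= A2 p q u v w.
Proof.
move=> q0 u0 w0; apply: ge_ereal_sup => _ [a a0 <-].
pose X j := \esum_(i in [set i : int | (i <= j)%R]) (a i)%:E.
apply: le_trans (_ : _ <= hardy_sum q w u X `^ q^-1 * vnorm_inv p v a) _; last first.
  by apply: ereal_sup_ubound; exists a.
apply: lee_wpmul2r; first by rewrite inve_ge0 poweR_ge0.
apply: le_poweR; rewrite ?invr_ge0 ?(ltW q0) //; first exact: hardy_sum_ge0.
apply: le_hardy_sum => //; first exact: ltW.
  by move=> j; exact: running_sup_ge0.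
move=> j; apply: ge_ereal_sup => _ [i ij <-].
apply: esum_ge; exists [set i]; first by split => // k ->.
by rewrite fsbig_set1.
Qed.

Lemma A2_le_A3 p q u v w : (0 < p)%R -> (p <= 1)%R -> (0 < q)%R ->
  nneg_seq u -> nneg_seq w -> A2 p q u v w <= A3 p q u v w.
Proof.
move=> p0 p1 q0 u0 w0; apply: ge_ereal_sup => _ [a a0 <-].
pose X j := \esum_(i in [set i : int | (i <= j)%R]) (a i)%:E.
pose Y j := \esum_(i in [set i : int | (i <= j)%R]) (a i `^ p)%:E.
have X0 j : 0 <= X j by apply: esum_ge0 => i _; rewrite lee_fin.
have Y0 j : 0 <= Y j by apply: esum_ge0 => i _; rewrite lee_fin powR_ge0.
apply: le_trans (_ : _ <= hardy_sum (q / p) w (fun j => u j `^ p)%R Y `^ q^-1 *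
  vnorm_inv p v a) _; last by apply: ereal_sup_ubound; exists a.
apply: lee_wpmul2r; first by rewrite inve_ge0 poweR_ge0.
apply: le_poweR; rewrite ?invr_ge0 ?(ltW q0) //; first exact: hardy_sum_ge0.
change (hardy_sum q w u X <= hardy_sum (q / p) w (fun j => u j `^ p)%R Y).
(* With equal exponents and weights on both sides, it remains to compare [X j ^ p] with [Y j]. *)
rewrite -(@hardy_sum_poweR _ p q) //.
apply: le_hardy_sum => //.
- by rewrite divr_ge0 ?ltW.
- by move=> j; exact: powR_ge0.
- by move=> j; exact: poweR_ge0.
- move=> j; rewrite -[leRHS](@poweRVK _ p) ?Y0 //.
  apply: le_poweR; rewrite ?(ltW p0) //.
  exact: esum_poweR_le.
Qed.

(** Tested on the zero sequence; this excludes the value [-oo]. *)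
Lemma A1_ge0 p q u v w : 0 <= A1 p q u v w.
Proof.
apply: (@le_trans _ _ (hardy_sum q w u (running_sup (fun=> 0%R)) `^ q^-1 *
  vnorm_inv p v (fun=> 0%R))).
  by rewrite mule_ge0 ?poweR_ge0 // inve_ge0 poweR_ge0.
by apply: ereal_sup_ubound; exists (fun=> 0%R) => // n; exact: lexx.
Qed.

Lemma A3_le_A1 p q u v w : (0 < p)%R -> (0 < q)%R ->
  nneg_seq u -> nneg_seq v -> nneg_seq w ->
  A3 p q u v w <= (4 `^ q^-1)%:E * A1 p q u v w.
Proof.
move=> p0 q0 u0 v0 w0; have := A1_ge0 p q u v w.
case A1E : (A1 p q u v w) => [A| |] // A0.
  by rewrite lee_fin in A0; exact: A3_le A1E.
(* The remaining case is [A1 = +oo], where a positive multiple is again [+oo]. *)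
have C0 : 0 < (4 `^ q^-1)%:E :> \bar R by rewrite lte_fin powR_gt0 ?ltr0n.
by rewrite (gt0_muley C0); exact: leey.
Qed.

End hardy.

Theorem theorem3p8 (R : realType) (q : R) (hq : 0 < q) :
  exists c C : R, [/\ 0 < c, 0 < C &
    forall (p : R) (u v w : int -> R),
      0 < p -> p <= 1 ->
      nneg_seq u -> nneg_seq v -> nneg_seq w ->
      [/\ equivalent_with c C (A1 p q u v w) (A2 p q u v w),
          equivalent_with c C (A1 p q u v w) (A3 p q u v w)
        & equivalent_with c C (A2 p q u v w) (A3 p q u v w)]].
Proof.
have C0 : 0 < 4 `^ q^-1 :> R by rewrite powR_gt0 ?ltr0n.
(* Both constants are fixed before [p] and the sequences. All pairs follow from the cycle
   [A1 <= A2 <= A3 <= 4 ^ (1 / q) * A1]. *)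
exists 1, (4 `^ q^-1); split => // p u v w p0 p1 u0 v0 w0.
have A12 := A1_le_A2 p v hq u0 w0.
have A23 := A2_le_A3 v p0 p1 hq u0 w0.
have A31 := A3_le_A1 p0 hq u0 v0 w0.
have C0e : (0 <= (4 `^ q^-1)%:E :> \bar R)%E by rewrite lee_fin ltW.
rewrite /equivalent_with !mul1e; split.
- exact: conj A12 (le_trans A23 A31).
- exact: conj (le_trans A12 A23) A31.
- exact: conj A23 (le_trans A31 (lee_wpmul2l C0e A12)).
Qed.
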